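(* Let $\mathbf A\in\mathbb H^{n\times n}$ be invertible and $\mathbf b\in\mathbb H^{n\times1}$ a constant column vector. The particular solution $\mathbf x(t)=-\mathbf A^{-1}\mathbf b=(x_1,\dots,x_n)^T$ of the right system $\mathbf x'(t)=\mathbf A\mathbf x(t)+\mathbf b$ possesses the following determinantal representations for all $i=1,\dots,n$: (i) if $\mathbf A$ is Hermitian, $\displaystyle x_i=-\frac{\operatorname{cdet}_i\mathbf A_{.i}(\mathbf b)}{\det\mathbf A}$; (ii) if $\mathbf A$ is arbitrary, $\displaystyle x_i=-\frac{\operatorname{cdet}_i(\mathbf A^{*}\mathbf A)_{.i}(\mathbf A^{*}\mathbf b)}{\operatorname{ddet}\mathbf A}$.
   Context: $\mathbb H$ is the real quaternion skew field; $\mathbf A^{*}$ is the conjugate transpose; $\mathbf A$ is Hermitian if $\mathbf A^*=\mathbf A$. Derivatives are componentwise in the real variable $t$. Column determinants: for $\mathbf M=(m_{ij})\in\mathbb H^{n\times n}$ and $j\in\{1,\dots,n\}$, $$\operatorname{cdet}_j\mathbf M=\sum_{\tau\in S_n}(-1)^{n-p}\,(m_{j_{k_p}j_{k_p+l_p}}\cdots m_{j_{k_p+1}j_{k_p}})\cdots(m_{j\,j_{k_1+l_1}}\cdots m_{j_{k_1+1}j_{k_1}}m_{j_{k_1}j}),$$ where $\tau$ is written as a product of its $p$ disjoint cycles (fixed points included) $\tau=(j_{k_p+l_p}\dots j_{k_p+1}j_{k_p})\cdots(j_{k_2+l_2}\dots j_{k_2+1}j_{k_2})(j_{k_1+l_1}\dots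 j_{k_1+1}j_{k_1}j)$ with $j_{k_2}<j_{k_3}<\dots<j_{k_p}$ and $j_{k_t}<j_{k_t+s}$ for $t=2,\dots,p$, $s=1,\dots,l_t$ (the cycle containing $j$ is the rightmost one; a fixed point $c$ contributes $m_{cc}$). For a Hermitian matrix all column determinants (and all row determinants) coincide and are real; their common value is $\det\mathbf M$. The double determinant is $\operatorname{ddet}\mathbf A:=\det(\mathbf A^{*}\mathbf A)=\det(\mathbf A\mathbf A^{*})$. $\mathbf M_{.i}(\mathbf c)$ is the matrix obtained from $\mathbf M$ by replacing its $i$th column by $\mathbf c$. *)

(* Defs.v *)
From HB Require Import structures.
From mathcomp Require Import all_boot all_order all_fingroup all_algebra.
From mathcomp Require Import ring.
From mathcomp Require Import classical_sets reals topology normedtype derive.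

Set Implicit Arguments.
Unset Strict Implicit.
Unset Printing Implicit Defensive.

Import Order.TTheory GRing.Theory Num.Theory.
Import numFieldNormedType.Exports.

Local Open Scope ring_scope.

(* [Quat a b c d] is a + b i + c j + d k. *)
Record quat (R : realType) := Quat { qre : R; qi : R; qj : R; qk : R }.

Section QuatRing.
Variable R : realType.
Implicit Types p q r : quat R.

Let tuple_of_quat q := (qre q, qi q, qj q, qk q).
Let quat_of_tuple (u : R * R * R * R) :=
  let: (a, b, c, d) := u in Quat a b c d.

Let tuple_of_quatK : cancel tuple_of_quat quat_of_tuple.
Proof. by case. Qed.

HB.instance Definition _ := Equality.copy (quat R) (can_type tuple_of_quatK).
HB.instance Definition _ := Choice.copy (quat R) (can_type tuple_of_quatK).

Definition qzero : quat R := Quat 0 0 0 0.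
Definition qone : quat R := Quat 1 0 0 0.
Definition qopp q := Quat (- qre q) (- qi q) (- qj q) (- qk q).
Definition qadd p q :=
  Quat (qre p + qre q) (qi p + qi q) (qj p + qj q) (qk p + qk q).
(* i^2 = j^2 = k^2 = ijk = -1 *)
Definition qmul p q :=
  Quat (qre p * qre q - qi p * qi q - qj p * qj q - qk p * qk q)
       (qre p * qi q + qi p * qre q + qj p * qk q - qk p * qj q)
       (qre p * qj q - qi p * qk q + qj p * qre q + qk p * qi q)
       (qre p * qk q + qi p * qj q - qj p * qi q + qk p * qre q).
Definition qscale (a : R) q := Quat (a * qre q) (a * qi q) (a * qj q) (a * qk q).

Fact qaddA : associative qadd.
Proof. by move=> [????] [????] [????]; congr Quat => /=; ring. Qed.
Fact qaddC : commutative qadd.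
Proof. by move=> [????] [????]; congr Quat => /=; ring. Qed.
Fact qadd0 : left_id qzero qadd.
Proof. by case=> *; congr Quat => /=; ring. Qed.
Fact qaddN : left_inverse qzero qopp qadd.
Proof. by case=> *; congr Quat => /=; ring. Qed.
HB.instance Definition _ :=
  GRing.isZmodule.Build (quat R) qaddA qaddC qadd0 qaddN.

Fact qmulA : associative qmul.
Proof. by move=> [????] [????] [????]; congr Quat => /=; ring. Qed.
Fact qmul1 : left_id qone qmul.
Proof. by case=> *; congr Quat => /=; ring. Qed.
Fact qmulr1 : right_id qone qmul.
Proof. by case=> *; congr Quat => /=; ring. Qed.
Fact qmulDl : left_distributive qmul qadd.
Proof. by move=> [????] [????] [????]; congr Quat => /=; ring. Qed.
Fact qmulDr : right_distributive qmul qadd.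
Proof. by move=> [????] [????] [????]; congr Quat => /=; ring. Qed.
Fact qone_neq0 : qone != qzero.
Proof. by apply/eqP => -[] /eqP; rewrite oner_eq0. Qed.
HB.instance Definition _ := GRing.Zmodule_isNzRing.Build (quat R)
  qmulA qmul1 qmulr1 qmulDl qmulDr qone_neq0.

Fact qscaleA a b q : qscale a (qscale b q) = qscale (a * b) q.
Proof. by case: q => *; congr Quat => /=; ring. Qed.
Fact qscale1 : left_id 1 qscale.
Proof. by case=> *; congr Quat => /=; ring. Qed.
Fact qscaleDr : right_distributive qscale qadd.
Proof. by move=> ? [????] [????]; congr Quat => /=; ring. Qed.
Fact qscaleDl q a b : qscale (a + b) q = qadd (qscale a q) (qscale b q).
Proof. by case: q => *; congr Quat => /=; ring. Qed.
HB.instance Definition _ := GRing.Zmodule_isLmodule.Build R (quat R)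
  qscaleA qscale1 qscaleDr qscaleDl.

Fact qscaleAl (a : R) p q : qscale a (qmul p q) = qmul (qscale a p) q.
Proof. by case: p => *; case: q => *; congr Quat => /=; ring. Qed.
HB.instance Definition _ := GRing.Lmodule_isLalgebra.Build R (quat R) qscaleAl.

Definition qconj q := Quat (qre q) (- qi q) (- qj q) (- qk q).

Definition is_qderive (t : R) (f : R -> quat R) (df : quat R) : Prop :=
  [/\ is_derive t 1 (fun u => qre (f u)) (qre df),
      is_derive t 1 (fun u => qi (f u)) (qi df),
      is_derive t 1 (fun u => qj (f u)) (qj df) &
      is_derive t 1 (fun u => qk (f u)) (qk df)].

End QuatRing.

Section QuatMatrix.
Variables (R : realType) (n : nat).
Implicit Types (A M : 'M[quat R]_n) (b c : 'cV[quat R]_n).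

Definition conjtrmx A : 'M[quat R]_n := (map_mx (@qconj R) A)^T.

Definition qhermitian A : Prop := conjtrmx A = A.

Definition replace_col M (i : 'I_n) c : 'M[quat R]_n :=
  \matrix_(k, l) if l == i then c k 0 else M k l.

(* The product m_(c, s c) m_(s c, s^2 c) ... m_(s^-1 c, c) along the cycle of
   [s] through [c]; a fixed point contributes m_(c, c). The cycle notation
   (a_l ... a_1 a_0) is read as a_(r+1) |-> a_r and a_0 |-> a_l, so with
   c = a_0 this is m_(a_0, a_l) ... m_(a_2, a_1) m_(a_1, a_0). *)
Definition cycle_prod M (s : 'S_n) (c : 'I_n) : quat R :=
  \prod_(x <- traject s c #|porbit s c|) M x (s x).

(* The least elements, in increasing order, of the cycles of [s] (fixed points
   included) that do not contain [j]. *)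
Definition cycle_leaders (s : 'S_n) (j : 'I_n) : seq 'I_n :=
  [seq c <- enum 'I_n |
    (c \notin porbit s j) && [forall (d | d \in porbit s c), (c <= d)%N]].

Definition cdet (j : 'I_n) M : quat R :=
  \sum_(s : 'S_n) (-1) ^+ (n - #|porbits s|) *
    ((\prod_(c <- rev (cycle_leaders s j)) cycle_prod M s c) *
     cycle_prod M s j).

(* The row determinant is ordered the other way round: the cycle of [j] comes
   first and the least elements of the remaining ones increase. *)
Definition rdet (j : 'I_n) M : quat R :=
  \sum_(s : 'S_n) (-1) ^+ (n - #|porbits s|) *
    (cycle_prod M s j *
     (\prod_(c <- cycle_leaders s j) cycle_prod M s c)).

(* The common real value of all column and row determinants, which exists for
   Hermitian [M]; 0 is only a default for when there is none. *)
Definition hdet M : R :=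
  xget 0 [set d : R | forall j : 'I_n, cdet j M = d%:A /\ rdet j M = d%:A]%classic.

Definition ddet A : R := hdet (conjtrmx A *m A).

Definition right_system_solution A b (x : R -> 'cV[quat R]_n) : Prop :=
  forall (t : R) (i : 'I_n),
    is_qderive t (fun u => x u i 0) ((A *m x t + b) i 0).

End QuatMatrix.

(* Main.v *)
Require Import Defs.
From HB Require Import structures.
From mathcomp Require Import all_boot all_order all_fingroup all_algebra.
From mathcomp Require Import ring zify.
From mathcomp Require Import classical_sets reals topology normedtype derive.
From mathcomp Require Import fintype finset.

(** Reversing one cycle of a permutation conjugates the product of the entries of
    a Hermitian matrix along it and leaves the other cycles and the sign alone.
    Averaged over these reversals, every cycle may be replaced by its real part
    ([average_cycles]). The factors then commute and forget the starting points
    of the cycles, so all row and column determinants of a Hermitian [A] equal one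
    real number, [principal_minor A set0], which is [hdet A].

    When column [i] of [A] is replaced, the cycles avoiding [i] may still be
    averaged ([cdet_averaged]). The entry from column [i] is the last factor
    on its cycle, so [cdet i] is right linear in that column, and
    for [b = A *m v] it becomes the sum over [k] of [v k 0] times the column
    determinant in which column [k] stands in place of column [i]. For [k = i]
    this is [hdet A]; for [k] different from [i] multiplication by the
    transposition of [i] and [k] pairs off the permutations and the sum vanishes
    ([sum_replace_other_col]). This is Cramer's rule, [hermitian_cramer].

    It remains to see that [d(A)], short for [hdet A], is nonzero when the
    Hermitian [A] is invertible. Write [d_Y(A)] for the principal minor with rows
    and columns [Y] deleted. It is affine in each diagonal entry, with
    [d_Y(A + a e_yy) = d_Y(A) + a d_(Y + y)(A)]. If [d(A) = 0], Cramer's rule for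
    a basis vector gives [d_y(A) = 0], hence [d(A + a e_yy) = 0], where
    [A + a e_yy] is again invertible for some nonzero [a]. Induction on the size
    of [Y], over all invertible Hermitian matrices with [d = 0] at once, shows
    that all [d_Y(A)] vanish. But the minor with everything deleted is [1].

    The general system is reduced to the Hermitian one by passing to the normal
    equations, whose matrix [conjtrmx A *m A] is Hermitian and invertible. *)

Set Implicit Arguments.
Unset Strict Implicit.
Unset Printing Implicit Defensive.

Import Order.TTheory GRing.Theory Num.Theory.

Local Open Scope ring_scope.

(** * Real parts and conjugates of quaternions *)

Section Quaternions.
Variable R : realType.
Implicit Types (p q : quat R) (a : R).

Lemma qconjK : involutive (@qconj R).
Proof. by case=> *; congr Quat => /=; ring. Qed.

Lemma qconjD p q : qconj (p + q) = qconj p + qconj q.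
Proof. by case: p => *; case: q => *; congr Quat => /=; ring. Qed.

Lemma qconjM p q : qconj (p * q) = qconj q * qconj p.
Proof. by case: p => *; case: q => *; congr Quat => /=; ring. Qed.

Lemma qconj_sum I (r : seq I) (P : pred I) (F : I -> quat R) :
  qconj (\sum_(i <- r | P i) F i) = \sum_(i <- r | P i) qconj (F i).
Proof.
by apply: (big_morph (@qconj R) qconjD); congr Quat => /=; rewrite oppr0.
Qed.

Lemma qconj_prod I (r : seq I) (F : I -> quat R) :
  qconj (\prod_(i <- r) F i) = \prod_(i <- rev r) qconj (F i).
Proof.
elim: r => [|i r IHr].
  by rewrite !big_nil; congr Quat => /=; rewrite oppr0.
by rewrite big_cons rev_cons -cats1 big_cat big_seq1 qconjM IHr.
Qed.

Lemma qreMC p q : qre (p * q) = qre (q * p).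
Proof. by case: p => *; case: q => * /=; ring. Qed.

Lemma qre_conj q : qre (qconj q) = qre q. Proof. by []. Qed.

Lemma qreD p q : qre (p + q) = qre p + qre q. Proof. by []. Qed.

Lemma quat_addConj q : q + qconj q = (2 * qre q)%:A.
Proof. by case: q => *; congr Quat => /=; ring. Qed.

Lemma quat_mulConj q :
  q * qconj q = (qre q ^+ 2 + qi q ^+ 2 + qj q ^+ 2 + qk q ^+ 2)%:A.
Proof. by case: q => *; congr Quat => /=; ring. Qed.

Lemma quat_scaleAr a p q : a *: (p * q) = p * (a *: q).
Proof. by case: p => *; case: q => *; congr Quat => /=; ring. Qed.

Lemma quat_mulA a q : q * a%:A = a *: q.
Proof. by rewrite -quat_scaleAr mulr1. Qed.

Lemma quat_scale_inj : injective (fun a : R => a%:A : quat R).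
Proof. by move=> a b [] /=; rewrite !mulr1. Qed.

Lemma quat_scale_prod I (r : seq I) (F : I -> R) :
  (\prod_(i <- r) F i)%:A = \prod_(i <- r) ((F i)%:A : quat R).
Proof.
elim: r => [|i r IHr]; first by rewrite !big_nil scale1r.
by rewrite !big_cons -IHr quat_mulA scalerA mulrC.
Qed.

Lemma quat_inv q : q != 0 ->
  exists p, p * q = 1 /\ q * p = 1.
Proof.
set N := qre q ^+ 2 + qi q ^+ 2 + qj q ^+ 2 + qk q ^+ 2 => qN0.
have N0 : N != 0.
  apply: contra qN0; rewrite /N !paddr_eq0 ?addr_ge0 ?sqr_ge0 // !sqrf_eq0.
  by case: (q) => ? ? ? ? /= /andP[/andP[/andP[/eqP-> /eqP->] /eqP->] /eqP->].
exists (N^-1 *: qconj q); split.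
  rewrite -scalerAl -[X in _ * X]qconjK quat_mulConj !qre_conj /= !sqrrN.
  by rewrite scalerA mulVf ?scale1r.
by rewrite -quat_scaleAr quat_mulConj scalerA mulVf ?scale1r.
Qed.

End Quaternions.

(** * Cycles of a permutation *)

Section Cycles.
Variable T : finType.
Implicit Types (s t : {perm T}) (c d x y : T).

Lemma porbit_next s x : porbit s (s x) = porbit s x.
Proof. by have := porbit_perm s 1 x; rewrite expg1. Qed.

Lemma next_in_porbit s x y : (s x \in porbit s y) = (x \in porbit s y).
Proof. by rewrite -!eq_porbit_mem porbit_next. Qed.

Lemma prev_in_porbit s x y : ((s^-1)%g x \in porbit s y) = (x \in porbit s y).
Proof. by rewrite -next_in_porbit permKV. Qed.

Lemma porbit_ind s x (P : T -> Prop) :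
  P x -> (forall y, P y -> P (s y)) -> forall y, y \in porbit s x -> P y.
Proof.
move=> Px Ps y /porbitP[i ->].
by elim: i => [|i IHi]; rewrite ?expg0 ?perm1 // expgSr permM; apply: Ps.
Qed.

Lemma porbit_sub_closed s x (C : {set T}) :
  x \in C -> (forall y, y \in C -> s y \in C) -> porbit s x \subset C.
Proof.
by move=> xC sC; apply/subsetP => y; apply: (@porbit_ind s x (fun z => z \in C)).
Qed.

Lemma eq_in_iter s t x :
  {in porbit s x, s =1 t} -> forall i, iter i t x = iter i s x.
Proof.
move=> est; elim=> //= i ->; rewrite est // -permX; exact: mem_porbit.
Qed.

Lemma eq_in_porbit s t x : {in porbit s x, s =1 t} -> porbit t x = porbit s x.
Proof.
move=> /eq_in_iter est; apply/setP => y.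
by apply/porbitP/porbitP => -[i ->]; exists i; rewrite !permX est.
Qed.

Lemma eq_in_traject s t x m :
  {in porbit s x, s =1 t} -> traject t x m = traject s x m.
Proof.
move=> /eq_in_iter est; apply: (@eq_from_nth _ x); rewrite !size_traject // => i im.
by rewrite !nth_traject ?est.
Qed.

Lemma porbit_disjoint_next s c x :
  x \notin porbit s c -> {in porbit s x, forall y, y \notin porbit s c}.
Proof.
move=> xc y yx; apply: contra xc => yc.
by move: yx yc; rewrite -!eq_porbit_mem => /eqP<-.
Qed.

Definition rev_cycle_fun s c x := if x \in porbit s c then (s^-1)%g x else s x.

Fact rev_cycle_inj s c : injective (rev_cycle_fun s c).
Proof.
move=> x y; rewrite /rev_cycle_fun.
case: ifPn => xc; case: ifPn => yc; do ?exact: perm_inj.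
  by move=> e; move: yc; rewrite -next_in_porbit -e prev_in_porbit xc.
by move=> e; move: xc; rewrite -next_in_porbit e prev_in_porbit yc.
Qed.

Definition rev_cycle s c : {perm T} := perm (@rev_cycle_inj s c).

Lemma rev_cycle_in s c x : x \in porbit s c -> rev_cycle s c x = (s^-1)%g x.
Proof. by rewrite permE /rev_cycle_fun => ->. Qed.

Lemma rev_cycle_out s c x : x \notin porbit s c -> rev_cycle s c x = s x.
Proof. by rewrite permE /rev_cycle_fun => /negPf->. Qed.

Lemma porbit_rev_cycle s c x : porbit (rev_cycle s c) x = porbit s x.
Proof.
have [xc|xc] := boolP (x \in porbit s c); last first.
  apply: eq_in_porbit => y yx; rewrite rev_cycle_out //.
  exact: porbit_disjoint_next xc y yx.
rewrite -(porbitV s); apply: eq_in_porbit => y; rewrite porbitV => yx.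
rewrite rev_cycle_in //; move: xc yx.
by rewrite -!eq_porbit_mem => /eqP<- /eqP->.
Qed.

Lemma rev_cycleK s c : rev_cycle (rev_cycle s c) c = s.
Proof.
apply/permP => x; have [xc|xc] := boolP (x \in porbit s c); last first.
  by rewrite rev_cycle_out ?porbit_rev_cycle // rev_cycle_out.
rewrite rev_cycle_in ?porbit_rev_cycle //; apply: (@perm_inj _ (rev_cycle s c)).
by rewrite permKV rev_cycle_in ?next_in_porbit // permK.
Qed.

Lemma porbits_rev_cycle s c : porbits (rev_cycle s c) = porbits s.
Proof. by apply: eq_imset => x; rewrite porbit_rev_cycle. Qed.

(** * Merging and splitting cycles by a transposition *)

(** A transposition changes the number of cycles by one, and comparing the counts
    for [s] and for its product tells which of the two merges and which splits. *)
Lemma same_cycle_mul_tperm s i k : i != k ->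
  (k \in porbit (s * tperm i k)%g i) = (k \notin porbit s i).
Proof.
move=> ik; have e : ((s * tperm i k)^-1 = tperm i k * s^-1)%g by rewrite invMg tpermV.
have h1 := porbits_mul_tperm s^-1%g k i.
have h2 := porbits_mul_tperm (tperm i k * s^-1)%g k i.
rewrite /= !(tpermC k i) tpermKg -e !porbitV !porbitsV eq_sym ik in h1 h2 *.
by case: (_ \in _) h1; case: (_ \in _) h2 => /=; lia.
Qed.

Section Merge.
Variables (s : {perm T}) (i k : T).
Hypotheses (ik : i != k) (ki : k \notin porbit s i).
Let t := (s * tperm i k)%g.

Let merged_closed x : (t x \in porbit s i :|: porbit s k) =
   (x \in porbit s i :|: porbit s k).
Proof.
rewrite /t permM; case: tpermP => [e|e|_ _].
- have -> : x = (s^-1)%g i by rewrite -e permK.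
  by rewrite !inE !prev_in_porbit !porbit_id orbT.
- have -> : x = (s^-1)%g k by rewrite -e permK.
  by rewrite !inE !prev_in_porbit !porbit_id orbT.
- by rewrite !inE !next_in_porbit.
Qed.

Lemma merge_out : {in ~: (porbit s i :|: porbit s k), forall x,
  {in porbit s x, s =1 t}}.
Proof.
move=> x; rewrite !inE negb_or => /andP[xi xk] y yx.
have yi := porbit_disjoint_next xi yx; have yk := porbit_disjoint_next xk yx.
rewrite /t permM tpermD //.
  by apply: contraNneq yi => e; rewrite -next_in_porbit -e porbit_id.
by apply: contraNneq yk => e; rewrite -next_in_porbit -e porbit_id.
Qed.

Let iter_merge x m : x \in [set i; k] -> (m < #|porbit s x|)%N ->
  iter m t x = iter m s x.
Proof.
move=> xik; elim: m => // m IHm ltm /=; rewrite IHm 1?ltnW // /t permM -iterS.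
have := uniq_traject_porbit s x.
case E: #|_| ltm => [//|l] ltm /= /andP[xn _].
have nx : iter m.+1 s x != x.
  apply: contraNneq xn => e; rewrite -{1}e iterSr.
  by apply/trajectP; exists m.
move: (mem_porbit s m.+1 x); rewrite permX => inx; move: nx inx.
have {xik} [->|->] : x = i \/ x = k by move: xik; rewrite !inE => /orP[]/eqP; [left|right].
all: move=> nx inx; case: tpermP => // e; move: nx inx; rewrite /= e ?eqxx //.
  by rewrite (negPf ki).
by rewrite porbit_sym (negPf ki).
Qed.

(** The merged cycle runs through the cycle of [i], jumps to [k] where it would
    have returned to [i], and runs through the cycle of [k]. *)
Lemma traject_merge m1 m2 : #|porbit s i| = m1 -> #|porbit s k| = m2 ->
  traject t i (m1 + m2) = traject s i m1 ++ traject s k m2.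
Proof.
move=> E1 E2; rewrite trajectD; congr (_ ++ _); last first.
  have -> : iter m1 t i = k.
    case: m1 E1 => [/eqP|m1 E1]; first by rewrite (negPf (card_porbit_neq0 _ _)).
    rewrite iterS iter_merge ?E1 ?inE ?eqxx // /t permM -iterS -E1.
    by rewrite iter_porbit tpermL.
  apply: (@eq_from_nth _ k); rewrite !size_traject // => m lm.
  by rewrite !nth_traject // iter_merge ?E2 // !inE eqxx orbT.
apply: (@eq_from_nth _ i); rewrite !size_traject // => m lm.
by rewrite !nth_traject // iter_merge ?E1 // !inE eqxx.
Qed.

Lemma porbit_merge : porbit t i = porbit s i :|: porbit s k.
Proof.
apply/eqP; rewrite eqEsubset porbit_sub_closed ?inE ?porbit_id //=; last first.
  by move=> y; rewrite merged_closed.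
have tr := traject_merge erefl erefl.
apply/subsetP => y; rewrite inE (porbit_traject s i) (porbit_traject s k).
rewrite -mem_cat -tr => /trajectP[m _ ->].
by rewrite -permX mem_porbit.
Qed.

Lemma card_porbit_merge : #|porbit t i| = (#|porbit s i| + #|porbit s k|)%N.
Proof.
rewrite porbit_merge cardsU; set X := _ :&: _.
suff -> : X = set0 by rewrite cards0 subn0.
apply/setP => y; rewrite !inE; apply/negP => /andP[yi yk].
move: yi yk ki; rewrite -!eq_porbit_mem => /eqP-> /eqP->.
by rewrite eqxx.
Qed.

End Merge.

End Cycles.

(** * Products along cycles *)

Section CycleProducts.
Variables (R : realType) (n : nat).
Implicit Types (A M N : 'M[quat R]_n) (s t : 'S_n) (c d i j k x : 'I_n).

Lemma hermitian_entry A i j : qhermitian A -> qconj (A i j) = A j i.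
Proof. by move=> /matrixP/(_ j i); rewrite !mxE. Qed.

Lemma eq_cycle_prod M N s t x :
    {in porbit s x, s =1 t} -> {in porbit s x, forall y, M y (s y) = N y (s y)} ->
  cycle_prod N t x = cycle_prod M s x.
Proof.
move=> st MN; rewrite /cycle_prod (eq_in_porbit st) (eq_in_traject _ st).
apply: eq_big_seq => y; rewrite -porbit_traject => yx.
by rewrite -st // MN.
Qed.

Lemma rev_traject s x m :
  iter m s x = x -> rev (traject s (s x) m) = traject (s^-1)%g x m.
Proof.
move=> mx; apply: (@eq_from_nth _ (s x)); rewrite size_rev !size_traject // => l lm.
rewrite nth_rev size_traject // nth_traject ?ltn_subrL ?(leq_ltn_trans _ lm) //.
rewrite (set_nth_default x) ?size_traject // nth_traject //.
rewrite -iterSr subnSK // -[in RHS]mx -[in RHS](subnKC (ltnW lm)) iterD.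
elim: l {lm} (iter _ s x) => // l IHl y.
by rewrite [RHS]iterSr [iter l.+1 s y]iterS permK.
Qed.

(** Along the reversed cycle each entry is transposed, hence conjugated, and the
    factors come in the opposite order, as in the conjugate of a product. *)
Lemma cycle_prodV A s c :
  qhermitian A -> cycle_prod A (s^-1)%g c = qconj (cycle_prod A s c).
Proof.
move=> hA; rewrite /cycle_prod porbitV qconj_prod.
rewrite -rev_traject ?iter_porbit //.
have -> : traject s (s c) #|porbit s c| = map s (traject s c #|porbit s c|).
  by move: #|porbit s c| => m; elim: m c => //= m IHm y; rewrite IHm.
rewrite -map_rev big_map; apply: eq_bigr => x _.
by rewrite permK hermitian_entry.
Qed.

Lemma cycle_prod_rev_in A s c :
  qhermitian A -> cycle_prod A (rev_cycle s c) c = qconj (cycle_prod A s c).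
Proof.
move=> hA; rewrite -cycle_prodV //; apply: eq_cycle_prod => // x.
by rewrite porbitV => xc; rewrite rev_cycle_in.
Qed.

Lemma cycle_prod_rev_out M s c x :
  x \notin porbit s c -> cycle_prod M (rev_cycle s c) x = cycle_prod M s x.
Proof.
move=> xc; apply: eq_cycle_prod => // y /(porbit_disjoint_next xc) yc.
by rewrite rev_cycle_out.
Qed.

(** Moving the starting point of a cycle permutes its factors cyclically, which
    is invisible to the real part. *)
Lemma qre_cycle_prod_porbit M s c d :
  d \in porbit s c -> qre (cycle_prod M s d) = qre (cycle_prod M s c).
Proof.
move: d; apply: porbit_ind => // x <-; rewrite /cycle_prod porbit_next.
case E: #|porbit s x| (iter_porbit s x) => [|m] mx.
  by move/eqP: E; rewrite (negPf (card_porbit_neq0 _ _)).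
rewrite trajectSr -iterSr mx -cats1 big_cat big_seq1 trajectS big_cons.
exact: qreMC.
Qed.

Lemma qre_cycle_prod_rev A s c x : qhermitian A ->
  qre (cycle_prod A (rev_cycle s c) x) = qre (cycle_prod A s x).
Proof.
move=> hA; have [xc|xc] := boolP (x \in porbit s c); last by rewrite cycle_prod_rev_out.
rewrite (@qre_cycle_prod_porbit _ _ c) ?porbit_rev_cycle // cycle_prod_rev_in //.
by rewrite qre_conj (qre_cycle_prod_porbit _ xc).
Qed.

(** Reversing one cycle conjugates its factor and changes nothing else; hence in
    a sum over all permutations each factor may be replaced by its mean with its
    conjugate, that is, by its real part. *)
Lemma average_cycles A (L : 'S_n -> seq 'I_n) (K1 K2 : 'S_n -> quat R) :
    qhermitian A ->
    (forall s c, L (rev_cycle s c) = L s) -> (forall s, uniq (L s)) ->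
    (forall s, {in L s &, forall c d, d \in porbit s c -> d = c}) ->
    (forall s c, c \in L s -> K1 (rev_cycle s c) = K1 s) ->
    (forall s c, c \in L s -> K2 (rev_cycle s c) = K2 s) ->
  \sum_s K1 s * (\prod_(c <- L s) cycle_prod A s c) * K2 s =
  \sum_s (\prod_(c <- L s) qre (cycle_prod A s c)) *: (K1 s * K2 s).
Proof.
move=> hA hL uL dL hK1 hK2.
(* [F t]: the factors of the cycles represented in [t] are already averaged. *)
pose val (t : seq 'I_n) s c : quat R :=
  if c \in t then (qre (cycle_prod A s c))%:A else cycle_prod A s c.
pose F (t : seq 'I_n) s := K1 s * (\prod_(c <- L s) val t s c) * K2 s.
have two0 : 2 != 0 :> R by rewrite pnatr_eq0.
have step c0 (t : seq 'I_n) : \sum_s F (c0 :: t) s = \sum_s F t s.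
  pose r s := if c0 \in L s then rev_cycle s c0 else s.
  have rK : involutive r.
    by move=> s; rewrite /r; case: (boolP (c0 \in L s)) => [h|/negPf h]; rewrite ?hL h ?rev_cycleK.
  have mean s : F (c0 :: t) s = 2^-1 *: (F t s + F t (r s)).
    apply: (scalerI two0); rewrite scalerA divff // scale1r scaler_nat mulr2n.
    have other c : c \in L s -> c != c0 ->
        (val (c0 :: t) s c = val t s c) * (val t (r s) c = val t s c).
      move=> cL cc0; rewrite /val inE (negPf cc0) /= /r; split=> //.
      case: (boolP (c0 \in L s)) => // c0L; rewrite cycle_prod_rev_out //.
      by apply: contra cc0 => /(dL s c0 c c0L cL)->.
    have [c0L|c0L] := boolP (c0 \in L s); last first.
      rewrite /r (negPf c0L); suff -> : F (c0 :: t) s = F t s by [].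
      congr (_ * _ * _); apply: eq_big_seq => c cL; rewrite other //.
      by apply: contraNneq c0L => <-.
    have [p1 [p2 Ls]] : exists p1 p2, L s = p1 ++ c0 :: p2.
      by case/splitPr: c0L => p1 p2; exists p1, p2.
    have [c01 c02] : c0 \notin p1 /\ c0 \notin p2.
      have := uL s; rewrite Ls cat_uniq /= negb_or.
      by case/and3P=> _ /andP[-> _] /andP[-> _].
    have mid : val (c0 :: t) s c0 + val (c0 :: t) s c0 = val t s c0 + val t (r s) c0.
      rewrite /val inE eqxx /= /r c0L cycle_prod_rev_in // qre_conj.
      case: ifP => // _; rewrite quat_addConj -scalerDl; congr (_ *: _); ring.
    have -> : F t (r s) = K1 s * (\prod_(c <- L s) val t (r s) c) * K2 s.
      by rewrite /F /r c0L hL hK1 // hK2.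
    rewrite /F Ls !big_cat !big_cons /=.
    have part (p : seq 'I_n) : {subset p <= L s} -> c0 \notin p ->
        (\prod_(c <- p) val (c0 :: t) s c = \prod_(c <- p) val t s c) *
        (\prod_(c <- p) val t (r s) c = \prod_(c <- p) val t s c).
      move=> sp c0p; split; apply: eq_big_seq => c cp; rewrite other ?sp //;
        by apply: contraNneq c0p => <-.
    have s1 : {subset p1 <= L s} by move=> c; rewrite Ls mem_cat => ->.
    have s2 : {subset p2 <= L s}.
      by move=> c; rewrite Ls mem_cat inE => ->; rewrite !orbT.
    rewrite !(part p1) // !(part p2) // -!mulrDl -!mulrDr -!mulrDl.
    by rewrite -mid !(mulrDl, mulrDr).
  rewrite (eq_bigr _ (fun s _ => mean s)) -scaler_sumr big_split /=.
  rewrite [X in _ + X](reindex_inj (inv_inj rK)) /=.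
  under [X in _ + X]eq_bigr do rewrite rK.
  by rewrite -mulr2n -scaler_nat scalerA mulVf ?scale1r.
have all_t (t : seq 'I_n) : \sum_s F t s = \sum_s F [::] s by elim: t => // c t <-.
transitivity (\sum_s F [::] s); first by [].
rewrite -(all_t (enum 'I_n)); apply: eq_bigr => s _.
rewrite /F /val; under eq_bigr do rewrite mem_enum inE.
by rewrite -quat_scale_prod quat_mulA scalerAl.
Qed.

End CycleProducts.

(** * The real determinant of a Hermitian matrix *)

Section HermitianDeterminant.
Variables (R : realType) (n : nat).
Implicit Types (A M N : 'M[quat R]_n) (s t : 'S_n) (c d i j k x : 'I_n).
Implicit Types (Y : {set 'I_n}) (b : 'cV[quat R]_n).

(** One representative of each cycle: its least element, as in [cycle_leaders]. *)
Definition leader s x := [forall (d | d \in porbit s x), (x <= d)%N].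

Lemma eq_leader s t x : porbit t x = porbit s x -> leader t x = leader s x.
Proof. by rewrite /leader => ->. Qed.

Lemma leader_uniq s x y : leader s x -> leader s y -> y \in porbit s x -> y = x.
Proof.
move=> /forallP/(_ y)/implyP lx /forallP/(_ x)/implyP ly yx.
by apply/val_inj/eqP; rewrite eqn_leq lx // ly // porbit_sym.
Qed.

Lemma leader_exists s k : exists2 x, x \in porbit s k & leader s x.
Proof.
case: (arg_minnP (fun x : 'I_n => val x) (porbit_id s k)) => x xk xmin.
have {}xk : x \in porbit s k := xk.
exists x => //; apply/forallP => d; apply/implyP => dx; apply: xmin.
change (d \in porbit s k).
by move: xk dx; rewrite -!eq_porbit_mem => /eqP->.
Qed.

(** Starting points do not matter for a function constant on cycles, so the
    factor of the cycle of [k] may be read off at [k] instead of at its leader. *)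
Lemma prod_leader_split (S : comNzRingType) s k (P : pred 'I_n) (f : 'I_n -> S) :
    {in porbit s k, forall x, P x} -> {in porbit s k, forall x, f x = f k} ->
  \prod_(x | leader s x && P x) f x =
  f k * \prod_(x | leader s x && (P x && (x \notin porbit s k))) f x.
Proof.
move=> Pk fk; have [x0 x0k l0] := leader_exists s k.
rewrite (bigD1 x0) ?l0 ?Pk //= fk //; congr (_ * _); apply: eq_bigl => x.
rewrite -andbA; case lx: (leader s x) => //=; case: (P x) => //=.
congr (~~ _); apply/eqP/idP => [-> //|xk].
apply: (leader_uniq l0 lx).
by move: x0k xk; rewrite -!eq_porbit_mem => /eqP->.
Qed.

Definition cycle_sign s : R := (-1) ^+ (n - #|porbits s|).

Lemma cycle_sign_rev s c : cycle_sign (rev_cycle s c) = cycle_sign s.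
Proof. by rewrite /cycle_sign porbits_rev_cycle. Qed.

Lemma card_porbits s : (#|porbits s| <= n)%N.
Proof. by rewrite (leq_trans (leq_imset_card _ _)) ?card_ord. Qed.

Lemma cycle_sign_odd s : cycle_sign s = (-1) ^+ odd_perm s.
Proof.
by rewrite /cycle_sign -signr_odd oddB ?card_porbits // /odd_perm card_ord.
Qed.

Lemma cycle_sign_tperm s i k : i != k ->
  cycle_sign (s * tperm i k)%g = - cycle_sign s.
Proof.
by move=> ik; rewrite !cycle_sign_odd odd_permM odd_tperm ik signr_addb mulrN1.
Qed.

Lemma quat_signM m (q : quat R) : (-1) ^+ m * q = ((-1) ^+ m : R) *: q.
Proof.
elim: m q => [|m IHm] q; first by rewrite mul1r scale1r.
by rewrite !exprS !mulN1r mulNr IHm scaleNr.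
Qed.

(** The determinant of the Hermitian matrix left from [A] by deleting the rows
    and columns in [Y], written over the permutations of the whole index set that
    fix [Y] pointwise. *)
Definition principal_minor A Y : R :=
  \sum_(s : 'S_n | [forall y in Y, s y == y])
    cycle_sign s * \prod_(x | leader s x && (x \notin Y)) qre (cycle_prod A s x).

(** The coefficient of the cycle of [i] in a determinant expanded at [i], once all
    the other cycles have been averaged with their reversals. *)
Definition averaged_weight A s i : R :=
  cycle_sign s *
    \prod_(x | leader s x && (x \notin porbit s i)) qre (cycle_prod A s x).

Lemma averaged_weight_rev A s i c : qhermitian A ->
  averaged_weight A (rev_cycle s c) i = averaged_weight A s i.
Proof.
move=> hA; rewrite /averaged_weight cycle_sign_rev; congr (_ * _).
apply: eq_big => [x|x _]; last exact: qre_cycle_prod_rev.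
by rewrite porbit_rev_cycle (eq_leader (porbit_rev_cycle _ _ _)).
Qed.

Lemma mem_cycle_leaders s j c :
  (c \in cycle_leaders s j) = (c \notin porbit s j) && leader s c.
Proof. by rewrite mem_filter mem_enum andbT. Qed.

Lemma cycle_leaders_rev_cycle s c j :
  cycle_leaders (rev_cycle s c) j = cycle_leaders s j.
Proof.
apply: eq_filter => x; rewrite porbit_rev_cycle.
by congr (_ && _); apply: eq_leader; rewrite porbit_rev_cycle.
Qed.

Lemma prod_cycle_leaders s j (f : 'I_n -> R) :
  \prod_(c <- cycle_leaders s j) f c =
  \prod_(x | leader s x && (x \notin porbit s j)) f x.
Proof. by rewrite big_filter big_enum_cond; apply: eq_bigl => x; rewrite /= andbC. Qed.

(** A cycle that avoids [i] sees only entries where [M] is Hermitian, so it may be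
    averaged even though row and column [i] of [M] are arbitrary. *)
Lemma cdet_averaged A M i : qhermitian A ->
    (forall x y, x != i -> y != i -> M x y = A x y) ->
  cdet i M = \sum_s averaged_weight A s i *: cycle_prod M s i.
Proof.
move=> hA AM.
have out s c : c \notin porbit s i -> cycle_prod M s c = cycle_prod A s c.
  move=> ci; apply: eq_cycle_prod => // y /(porbit_disjoint_next ci) yi.
  rewrite -AM //; first by apply: contraNneq yi => ->; rewrite porbit_id.
  by apply: contraNneq yi => e; rewrite -next_in_porbit e porbit_id.
pose K1 s : quat R := (-1) ^+ (n - #|porbits s|).
transitivity (\sum_s K1 s * (\prod_(c <- rev (cycle_leaders s i)) cycle_prod A s c)
                * cycle_prod M s i).
  apply: eq_bigr => s _; rewrite mulrA; congr (_ * _ * _).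
  apply: eq_big_seq => c; rewrite mem_rev mem_cycle_leaders => /andP[ci _].
  exact: out.
rewrite (average_cycles hA).
- apply: eq_bigr => s _; rewrite /K1 quat_signM scalerA mulrC; congr (_ *: _).
  by rewrite (perm_big (cycle_leaders s i)) ?perm_rev // prod_cycle_leaders.
- by move=> s c; rewrite cycle_leaders_rev_cycle.
- by move=> s; rewrite rev_uniq filter_uniq ?enum_uniq.
- move=> s c d; rewrite !mem_rev !mem_cycle_leaders => /andP[_ lc] /andP[_ ld].
  exact: leader_uniq.
- by move=> s c _; rewrite /K1 porbits_rev_cycle.
- move=> s c; rewrite mem_rev mem_cycle_leaders => /andP[ci _].
  by rewrite cycle_prod_rev_out // porbit_sym.
Qed.

Lemma weight_cycle A s i :
  averaged_weight A s i * qre (cycle_prod A s i) =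
  cycle_sign s * \prod_(x | leader s x && (x \notin set0)) qre (cycle_prod A s x).
Proof.
rewrite (@prod_leader_split _ s i) => [|x _|x xi]; last exact: qre_cycle_prod_porbit.
  rewrite /averaged_weight -mulrA [X in _ * X]mulrC; congr (_ * (_ * _)).
  by apply: eq_bigl => x; rewrite !inE.
by rewrite inE.
Qed.

(** For a Hermitian matrix the cycle of [i] may be averaged as well. *)
Lemma sum_weight_cycle A i (hA : qhermitian A) :
  \sum_s averaged_weight A s i *: cycle_prod A s i = (principal_minor A set0)%:A.
Proof.
transitivity (\sum_s (averaged_weight A s i)%:A *
    (\prod_(c <- [:: i]) cycle_prod A s c) * 1).
  by apply: eq_bigr => s _; rewrite big_seq1 mulr1 -scalerAl mul1r.
rewrite (average_cycles hA (L := fun=> [:: i])) //; last first.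
- by move=> s c _; rewrite averaged_weight_rev.
- by move=> s c d; rewrite !inE => /eqP-> /eqP->.
rewrite /principal_minor scaler_suml; apply: eq_big => [s|s _].
  by apply/esym/forallP => y; rewrite inE.
by rewrite big_seq1 mulr1 scalerA mulrC weight_cycle.
Qed.

Lemma cdet_hermitian A j : qhermitian A -> cdet j A = (principal_minor A set0)%:A.
Proof. by move=> hA; rewrite (cdet_averaged hA) // sum_weight_cycle. Qed.

Lemma rdet_hermitian A j : qhermitian A -> rdet j A = (principal_minor A set0)%:A.
Proof.
move=> hA; rewrite -(sum_weight_cycle j hA).
pose K1 s : quat R := (-1) ^+ (n - #|porbits s|) * cycle_prod A s j.
transitivity (\sum_s K1 s * (\prod_(c <- cycle_leaders s j) cycle_prod A s c) * 1).
  by apply: eq_bigr => s _; rewrite mulr1 mulrA.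
rewrite (average_cycles hA) //.
- apply: eq_bigr => s _; rewrite mulr1 /K1 quat_signM scalerA mulrC.
  by rewrite prod_cycle_leaders.
- by move=> s c; rewrite cycle_leaders_rev_cycle.
- by move=> s; rewrite filter_uniq ?enum_uniq.
- move=> s c d; rewrite !mem_cycle_leaders => /andP[_ lc] /andP[_ ld].
  exact: leader_uniq.
- move=> s c; rewrite mem_cycle_leaders => /andP[cj _].
  by rewrite /K1 porbits_rev_cycle cycle_prod_rev_out // porbit_sym.
Qed.

Lemma hdet_principal_minor A : (0 < n)%N -> qhermitian A ->
  hdet A = principal_minor A set0.
Proof.
move=> n_gt0 hA; apply: xget_unique => [|d hd].
  by move=> j; rewrite cdet_hermitian ?rdet_hermitian.
have [+ _] := hd (Ordinal n_gt0); rewrite cdet_hermitian // => e.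
exact/esym/quat_scale_inj.
Qed.

(** * Cramer's rule for Hermitian matrices *)

(** Column [i] is entered exactly once along the cycle of [i], by its last step. *)
Lemma cycle_prod_replace_col A s i b :
  cycle_prod (replace_col A i b) s i =
  (\prod_(x <- traject s i #|porbit s i|.-1) A x (s x)) * b ((s^-1)%g i) 0.
Proof.
rewrite /cycle_prod; have := uniq_traject_porbit s i; have := iter_porbit s i.
case: #|porbit s i| (card_porbit_neq0 s i) => // m _ it.
rewrite trajectSr rcons_uniq => /andP[itm U]; rewrite -cats1 big_cat big_seq1 /=.
have -> : (s^-1)%g i = iter m s i by rewrite -{1}it iterS permK.
rewrite mxE -iterS it eqxx; congr (_ * _); apply: eq_big_seq => x xt.
rewrite mxE; case: eqP => // sx; case/negP: itm.
by have -> : iter m s i = x by apply: (@perm_inj _ s); rewrite sx -iterS it.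
Qed.

(** Adding a transposition splits the cycle through [i] and [k] of a permutation
    in two, flips the sign and, columns [i] and [k] of the matrix being equal,
    keeps all factors. The two halves of the permutations cancel after averaging
    over the direction of the cycle of [k]. *)
Lemma sum_replace_other_col A i k : qhermitian A -> i != k ->
  \sum_s averaged_weight A s i *: cycle_prod (replace_col A i (col k A)) s i = 0.
Proof.
move=> hA ik; set M := replace_col _ _ _.
have Mik x y : M x (tperm i k y) = M x y.
  by case: tpermP => [->|->|//]; rewrite !mxE ?eqxx // eq_sym (negPf ik).
have out s c : c \notin porbit s i -> cycle_prod M s c = cycle_prod A s c.
  move=> ci; apply: eq_cycle_prod => // y /(porbit_disjoint_next ci) yi.
  rewrite mxE; case: eqP => // e.
  by move: yi; rewrite -next_in_porbit e porbit_id.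
rewrite (bigID (fun s => k \in porbit s i)) /=.
have tK : involutive (fun s => s * tperm i k)%g.
  by move=> s; rewrite -mulgA tperm2 mulg1.
rewrite (reindex_inj (inv_inj tK)) /=.
under eq_bigl => s do rewrite same_cycle_mul_tperm //.
(* [W s]: the cycles of [s] through neither [i] nor [k]. *)
pose W s := \prod_(x | leader s x && ((x \notin porbit s i) && (x \notin porbit s k)))
  qre (cycle_prod A s x).
have merged s : k \notin porbit s i ->
    averaged_weight A (s * tperm i k)%g i *: cycle_prod M (s * tperm i k)%g i =
    - ((cycle_sign s * W s) *: (cycle_prod M s i * cycle_prod A s k)).
  move=> ki; rewrite /averaged_weight cycle_sign_tperm // !mulNr scaleNr.
  congr (- (_ * _ *: _)).
    have mo := merge_out (s := s) (i := i) (k := k).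
    apply: eq_big => [x|x /andP[_]]; rewrite porbit_merge // !inE negb_or.
      have [xik|] := boolP (x \in ~: (porbit s i :|: porbit s k)); last first.
        by rewrite !inE negbK => /orP[]->; rewrite ?andbF.
      by rewrite (eq_leader (eq_in_porbit (mo _ xik))).
    move=> xik; congr qre; apply: eq_cycle_prod => //.
    by apply: mo; rewrite !inE negb_or.
  rewrite -out // /cycle_prod card_porbit_merge // traject_merge // big_cat.
  congr (_ * _); apply: eq_bigr => x _; rewrite permM Mik //.
rewrite (eq_bigr _ merged) sumrN addrC; apply/eqP; rewrite subr_eq0; apply/eqP.
pose K s : quat R :=
  if k \in porbit s i then 0 else (cycle_sign s * W s) *: cycle_prod M s i.
transitivity (\sum_s K s * (\prod_(c <- [:: k]) cycle_prod A s c) * 1).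
  rewrite (average_cycles hA (L := fun=> [:: k])) //; first last.
  - move=> s c; rewrite inE => /eqP-> {c}; rewrite /K porbit_rev_cycle.
    case: ifPn => // ki; congr (_ * _ *: _); first exact: cycle_sign_rev.
      apply: eq_big => [x|x _]; last exact: qre_cycle_prod_rev.
      by rewrite !porbit_rev_cycle (eq_leader (porbit_rev_cycle _ _ _)).
    by rewrite cycle_prod_rev_out // porbit_sym.
  - by move=> s c d; rewrite !inE => /eqP-> /eqP->.
  rewrite [RHS](bigID (fun s => k \in porbit s i)) /= [X in _ = X + _]big1 ?add0r.
    apply: eq_bigr => s ki; rewrite /K (negPf ki) big_seq1 mulr1 scalerA.
    congr (_ *: _); rewrite /averaged_weight (@prod_leader_split _ s k).
    - by rewrite mulrCA.
    - by move=> x xk; apply: contra ki; rewrite -!eq_porbit_mem in xk *; move/eqP: xk => ->.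
    - by move=> x; exact: qre_cycle_prod_porbit.
  by move=> s ki; rewrite /K ki mul0r scaler0.
rewrite (bigID (fun s => k \in porbit s i)) /= big1 ?add0r.
  apply: eq_bigr => s ki; rewrite /K (negPf ki) big_seq1 mulr1.
  by rewrite -scalerAl.
by move=> s ki; rewrite /K ki !mul0r.
Qed.

Lemma cdet_replace_col A i b : qhermitian A ->
  cdet i (replace_col A i b) =
  \sum_s averaged_weight A s i *: cycle_prod (replace_col A i b) s i.
Proof.
by move=> hA; apply: cdet_averaged => // x y _ yi; rewrite mxE (negPf yi).
Qed.

(** Right linearity in the replaced column leaves one term per column of [A]; only
    the one that puts column [i] back survives. *)
Lemma hermitian_cramer A (v : 'cV[quat R]_n) i : qhermitian A ->
  cdet i (replace_col A i (A *m v)) = principal_minor A set0 *: v i 0.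
Proof.
move=> hA; rewrite cdet_replace_col //.
transitivity (\sum_k (\sum_s averaged_weight A s i *:
    cycle_prod (replace_col A i (col k A)) s i) * v k 0).
  under [RHS]eq_bigr do rewrite big_distrl.
  rewrite exchange_big; apply: eq_bigr => s _.
  rewrite cycle_prod_replace_col mxE mulr_sumr scaler_sumr; apply: eq_bigr => k _.
  by rewrite cycle_prod_replace_col mxE /= -scalerAl mulrA.
rewrite (bigD1 i) //= [X in _ + X]big1 ?addr0 => [|k ki].
  have -> : replace_col A i (col i A) = A.
    by apply/matrixP => x y; rewrite !mxE; case: eqP => // ->.
  by rewrite sum_weight_cycle // -scalerAl mul1r.
by rewrite sum_replace_other_col ?mul0r // eq_sym.
Qed.

End HermitianDeterminant.

(** * Nonvanishing of the determinant of an invertible Hermitian matrix *)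

Section Nonvanishing.
Variables (R : realType) (n : nat).
Implicit Types (A : 'M[quat R]_n) (s t : 'S_n) (c d i j k x y : 'I_n).
Implicit Types (Y : {set 'I_n}) (a : R).

Definition shift_diag A y a : 'M[quat R]_n := A + a%:A *: delta_mx y y.

Lemma shift_diagE A y a i j :
  shift_diag A y a i j = A i j + (a *+ ((i == y) && (j == y)))%:A.
Proof.
by rewrite !mxE; case: (_ && _); rewrite ?mulr1 ?mulr0 ?mulr1n ?mulr0n ?scale0r.
Qed.

Lemma shift_diag_hermitian A y a : qhermitian A -> qhermitian (shift_diag A y a).
Proof.
move=> hA; apply/matrixP => i j; rewrite mxE mxE !shift_diagE qconjD.
rewrite hermitian_entry // andbC; congr (_ + _).
by congr Quat; rewrite /= ?mulr0 ?oppr0.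
Qed.

Lemma porbit_fixed s x : s x = x -> porbit s x = [set x].
Proof.
move=> sx; apply/eqP; rewrite eqEsubset sub1set porbit_id andbT.
by apply: porbit_sub_closed; rewrite ?inE // => y; rewrite !inE => /eqP->; rewrite sx.
Qed.

Lemma leader_fixed s x : s x = x -> leader s x.
Proof.
by move=> sx; apply/forallP => d; apply/implyP; rewrite porbit_fixed // inE => /eqP->.
Qed.

Lemma cycle_prod_fixed A s x : s x = x -> cycle_prod A s x = A x x.
Proof. by move=> sx; rewrite /cycle_prod porbit_fixed // cards1 big_seq1 sx. Qed.

(** A permutation sees the entry [A y y] only when it fixes [y], and then as one
    linear factor. *)
Lemma principal_minor_shift A Y y a : y \notin Y ->
  principal_minor (shift_diag A y a) Y =
  principal_minor A Y + a * principal_minor A (y |: Y).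
Proof.
move=> yY; rewrite /principal_minor.
rewrite (bigID (fun s : 'S_n => s y == y)) [in RHS](bigID (fun s : 'S_n => s y == y)) /=.
rewrite addrAC; congr (_ + _); last first.
  apply: eq_bigr => s /andP[_ sy]; congr (_ * _); apply: eq_bigr => x _.
  congr qre; apply: eq_cycle_prod => // z _; rewrite shift_diagE.
  by case: eqP => [->|_] /=; rewrite ?(negPf sy) mulr0n scale0r addr0.
have cond s : ([forall z in y |: Y, s z == z]) =
    [forall z in Y, s z == z] && (s y == y).
  apply/idP/idP => [/forall_inP h|/andP[/forall_inP h sy]].
    by rewrite h ?setU11 // andbT; apply/forall_inP => z zY; rewrite h ?setU1r.
  by apply/forall_inP => z; rewrite !inE => /orP[/eqP->|/h].
rewrite (eq_bigl _ _ cond) mulr_sumr -big_split; apply: eq_bigr => s /andP[_ /eqP sy].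
rewrite /= mulrCA -mulrDr; congr (_ * _).
have split_y (B : 'M[quat R]_n) :
    \prod_(x | leader s x && (x \notin Y)) qre (cycle_prod B s x) =
    qre (B y y) *
      \prod_(x | leader s x && (x \notin y |: Y)) qre (cycle_prod B s x).
  rewrite (bigD1 y) ?leader_fixed ?yY //= cycle_prod_fixed //; congr (_ * _).
  by apply: eq_bigl => x; rewrite !inE negb_or -andbA [(_ != y) && _]andbC.
rewrite !split_y shift_diagE !eqxx mulr1n qreD /= mulr1 mulrDl; congr (_ * _ + _ * _).
all: apply: eq_bigr => x; rewrite !inE negb_or => /and3P[_ xy _]; congr qre.
all: apply: eq_cycle_prod => // z zx; rewrite shift_diagE.
all: case: eqP => [zy|_] /=; rewrite ?mulr0n ?scale0r ?addr0 //.
all: by move: zx; rewrite zy porbit_sym porbit_fixed // inE (negPf xy).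
Qed.

Lemma principal_minor_setT A : principal_minor A [set: 'I_n] = 1.
Proof.
rewrite /principal_minor (big_pred1 (1%g : 'S_n)) => [|s /=]; last first.
  apply/forall_inP/eqP => [h|-> z _]; last by rewrite perm1.
  by apply/permP => x; rewrite perm1; apply/eqP; rewrite h ?inE.
rewrite big_pred0 => [|x]; last by rewrite !inE andbF.
by rewrite cycle_sign_odd odd_perm1 mulr1.
Qed.

(** The last step along the cycle of [i] meets the basis vector [delta_mx i 0]
    only when [i] is fixed. *)
Lemma cdet_basis_col A i : qhermitian A ->
  cdet i (replace_col A i (delta_mx i 0)) = (principal_minor A [set i])%:A.
Proof.
move=> hA; rewrite cdet_replace_col // /principal_minor scaler_suml.
rewrite (bigID (fun s : 'S_n => s i == i)) /= [X in _ + X]big1 ?addr0.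
  apply: eq_big => [s|s /eqP si].
    apply/idP/forall_inP => [si y|h]; first by rewrite inE => /eqP->.
    by apply: h; rewrite inE.
  rewrite cycle_prod_fixed // !mxE !eqxx; congr (_ * _ *: _).
  by apply: eq_bigl => x; rewrite porbit_fixed.
move=> s si; rewrite cycle_prod_replace_col mxE eqxx andbT.
case: eqP => [e|]; last by rewrite mulr0 scaler0.
by move: si; rewrite -{1}e permKV eqxx.
Qed.

(** By the Sherman-Morrison formula for rank-one updates it is enough that
    [1 + a *: Ainv y y] be nonzero, and this cannot fail both for [a = 1] and for
    [a = 2]. *)
Lemma shift_diag_invertible A Ainv y :
    A *m Ainv = 1%:M -> Ainv *m A = 1%:M ->
  exists a, a != 0 /\ exists B,
    shift_diag A y a *m B = 1%:M /\ B *m shift_diag A y a = 1%:M.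
Proof.
move=> AV VA; set c := Ainv y y.
have [a [a0 u0]] : exists a : R, a != 0 /\ 1 + a *: c != 0.
  have [e1|n1] := eqVneq (1 + c) 0; last by exists 1; rewrite oner_eq0 scale1r.
  exists 2; rewrite pnatr_eq0; split=> //.
  rewrite scaler_nat mulr2n addrA e1 add0r; apply/eqP => c0.
  by move/eqP: e1; rewrite c0 addr0 oner_eq0.
exists a; split=> //; have [u [ul ur]] := quat_inv u0.
pose e : 'cV[quat R]_n := delta_mx y 0; pose f : 'rV[quat R]_n := delta_mx 0 y.
have sE : shift_diag A y a = A + e *m (a%:A)%:M *m f.
  rewrite /shift_diag; congr (_ + _); apply/matrixP => i j.
  rewrite !mxE big_ord1 !mxE big_ord1 !mxE !eqxx andbT /=.
  case: (i == y); case: (j == y);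
    by rewrite /= ?mulr1n ?mulr0n ?mulr0 ?mul0r ?mulr1 ?mul1r.
have fVe : f *m Ainv *m e = c%:M.
  apply/matrixP => i j; rewrite !ord1 -rowE -colE !mxE.
  by rewrite /= mulr1n.
(* [u] is the inverse of [1 + a *: Ainv y y]. *)
exists (Ainv - Ainv *m e *m (a *: u)%:M *m (f *m Ainv)).
have mid1 : (a%:A)%:M - (a *: u)%:M - (a%:A)%:M *m c%:M *m (a *: u)%:M = 0 :> 'M_1.
  suff e0 : a%:A - a *: u - a%:A * c * (a *: u) = 0.
    by rewrite -!scalar_mxM -!(raddfB scalar_mx) e0 raddf0.
  apply/eqP; rewrite -addrA -opprD subr_eq0 -{1}ur mulrDl mul1r scalerDr.
  by rewrite -!scalerAl mul1r -!quat_scaleAr.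
have mid2 : (a%:A)%:M - (a *: u)%:M - (a *: u)%:M *m c%:M *m (a%:A)%:M = 0 :> 'M_1.
  suff e0 : a%:A - a *: u - a *: u * c * a%:A = 0.
    by rewrite -!scalar_mxM -!(raddfB scalar_mx) e0 raddf0.
  apply/eqP; rewrite -addrA -opprD subr_eq0 -{1}ul mulrDr mulr1 scalerDr.
  by rewrite quat_mulA -!scalerAl -!quat_scaleAr.
move: (a%:A)%:M (a *: u)%:M c%:M sE fVe mid1 mid2 => al ka ga -> fVe mid1 mid2.
split.
  transitivity (1%:M + e *m (al - ka - al *m ga *m ka) *m (f *m Ainv)); last first.
    by rewrite mid1 mulmx0 mul0mx addr0.
  rewrite -fVe mulmxDl !mulmxBr !mulmxBl !mulmxA AV mul1mx -addrA; congr (_ + _).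
  by rewrite addrA [- _ + _]addrC.
transitivity (1%:M + Ainv *m e *m (al - ka - ka *m ga *m al) *m f); last first.
  by rewrite mid2 mulmx0 mul0mx addr0.
rewrite -fVe mulmxBl !mulmxDr !mulmxDl !(mulmxN, mulNmx) !mulmxA VA.
rewrite -(mulmxA _ Ainv A) VA mulmx1 -addrA; congr (_ + _).
by rewrite opprD addrA.
Qed.

(** If the determinant vanished, so would every principal minor, the empty one
    included. *)
Lemma hermitian_minor_neq0 A Ainv : qhermitian A ->
    A *m Ainv = 1%:M -> Ainv *m A = 1%:M ->
  principal_minor A set0 != 0.
Proof.
move=> hA AV VA; apply/negP => /eqP d0.
(* The matrix varies in the induction: the step applies it to a shifted one. *)
suff all0 m : forall Y A Ainv, #|Y| = m -> qhermitian A ->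
    A *m Ainv = 1%:M -> Ainv *m A = 1%:M -> principal_minor A set0 = 0 ->
    principal_minor A Y = 0.
  by move/eqP: (all0 _ [set: 'I_n] _ _ erefl hA AV VA d0);
    rewrite principal_minor_setT oner_eq0.
move=> {A Ainv hA AV VA d0}; elim: m => [|m IHm] Y A Ainv.
  by move/cards0_eq=> ->.
move=> cY hA AV VA d0.
have /card_gt0P[y yY] : (0 < #|Y|)%N by rewrite cY.
have [a [a0 [B [AB BA]]]] := shift_diag_invertible y AV VA.
have m1 : principal_minor A [set y] = 0.
  apply: (@quat_scale_inj R); rewrite -cdet_basis_col // scale0r.
  by rewrite -[delta_mx _ _]mul1mx -AV -mulmxA hermitian_cramer // d0 scale0r.
have d0' : principal_minor (shift_diag A y a) set0 = 0.
  by rewrite principal_minor_shift ?inE // setU0 d0 m1 mulr0 addr0.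
have cY' : #|Y :\ y| = m by move: cY; rewrite (cardsD1 y) yY => -[].
have := IHm _ _ _ cY' (shift_diag_hermitian y a hA) AB BA d0'.
rewrite principal_minor_shift ?setD11 // setD1K // (IHm _ _ _ cY' hA AV VA d0) add0r.
by move/eqP; rewrite mulf_eq0 (negPf a0) /= => /eqP.
Qed.

End Nonvanishing.

(** * The determinantal representations *)

Section Systems.
Variables (R : realType) (n : nat).
Implicit Types (A B : 'M[quat R]_n) (b : 'cV[quat R]_n).

Lemma conjtrmxM A B : conjtrmx (A *m B) = conjtrmx B *m conjtrmx A.
Proof.
apply/matrixP => i j; rewrite !mxE qconj_sum; apply: eq_bigr => k _.
by rewrite qconjM !mxE.
Qed.

Lemma conjtrmxK : involutive (@conjtrmx R n).
Proof. by move=> A; apply/matrixP => i j; rewrite !mxE qconjK. Qed.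

Lemma conjtrmx1 : conjtrmx 1%:M = 1%:M :> 'M[quat R]_n.
Proof.
apply/matrixP => i j; rewrite !mxE eq_sym.
by case: (i == j); congr Quat; rewrite /= ?oppr0.
Qed.

Lemma gram_hermitian A : qhermitian (conjtrmx A *m A).
Proof. by rewrite /qhermitian conjtrmxM conjtrmxK. Qed.

Lemma cramer_solution A Ainv b : (0 < n)%N -> qhermitian A ->
    A *m Ainv = 1%:M -> Ainv *m A = 1%:M ->
  hdet A != 0 /\ forall i, (- (Ainv *m b)) i 0 =
     - ((hdet A)^-1 *: cdet i (replace_col A i b)).
Proof.
move=> n_gt0 hA AV VA; rewrite hdet_principal_minor //.
have d0 := hermitian_minor_neq0 hA AV VA; split=> // i.
rewrite mxE -[b in RHS]mul1mx -AV -mulmxA hermitian_cramer //.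
by rewrite scalerA mulVf ?scale1r.
Qed.

Lemma constant_solution A Ainv b : A *m Ainv = 1%:M ->
  right_system_solution A b (fun _ : R => - (Ainv *m b)).
Proof.
move=> AV t i.
have -> : (A *m (- (Ainv *m b)) + b) i 0 = 0.
  by rewrite mulmxN mulmxA AV mul1mx addNr mxE.
by split; apply: is_derive_cst.
Qed.

End Systems.

Theorem mainTheorem3 (R : realType) (n : nat) (n_gt0 : (0 < n)%N)
    (A Ainv : 'M[quat R]_n) (b : 'cV[quat R]_n)
    (AAinv : A *m Ainv = 1%:M) (AinvA : Ainv *m A = 1%:M) :
  let x : 'cV[quat R]_n := - (Ainv *m b) in
  [/\ right_system_solution A b (fun _ : R => x),
      qhermitian A ->
        hdet A != 0 /\
        forall i : 'I_n,
          x i 0 = - ((hdet A)^-1 *: cdet i (replace_col A i b)) &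
      ddet A != 0 /\
      forall i : 'I_n,
        x i 0 = - ((ddet A)^-1 *:
          cdet i (replace_col (conjtrmx A *m A) i (conjtrmx A *m b)))].
Proof.
move=> x; split; first exact: constant_solution.
  by move=> hA; apply: cramer_solution.
have AV : conjtrmx Ainv *m conjtrmx A = 1%:M by rewrite -conjtrmxM AAinv conjtrmx1.
have VA : conjtrmx A *m conjtrmx Ainv = 1%:M by rewrite -conjtrmxM AinvA conjtrmx1.
have -> : x = - ((Ainv *m conjtrmx Ainv) *m (conjtrmx A *m b)).
  by rewrite mulmxA -(mulmxA Ainv) AV mulmx1.
apply: cramer_solution => //; first exact: gram_hermitian.
  by rewrite mulmxA -(mulmxA _ A) AAinv mulmx1.
by rewrite mulmxA -(mulmxA Ainv) AV mulmx1.
Qed.
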